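(* Fix an integer $d \ge 15$. Then $V_n$ converges almost surely as $n\to\infty$.
   Context: $\mathbb{T}_d$ is the infinite rooted $d$-ary tree (every vertex has exactly $d$ children), with root $\rho$. The height $|v|$ of a vertex is its distance from $\rho$; $v$ is even (odd) if $|v|$ is even (odd). $N(v)$ is the set of children of $v$. Each edge $e$ carries a cookie $X_e$, where the $X_e$ are i.i.d. uniform on $\{-1,+1\}$, all defined on one probability space; for an edge between $v$ and its child $u$ we write $X_{uv}$. For $n\ge 0$ and vertices $v$ with $|v|\le 2n$, define $V_n(v)=0$ if $|v|=2n$, and for $|v|<2n$ recursively $$V_n(v)=\max\{X_{uv}+V_n(u): u\in N(v)\}\ (v \text{ even}),\qquad V_n(v)=\min\{X_{uv}+V_n(u): u\in N(v)\}\ (v\text{ odd}).$$ $V_n:=V_n(\rho)$ is the value of the $n$-round game. The same cookies are used for all $n$. *)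

(* Defs.v *)
From HB Require Import structures.
From mathcomp Require Import all_boot all_order all_algebra.
From mathcomp Require Import all_classical all_reals all_analysis.
Set Implicit Arguments.
Unset Strict Implicit.
Unset Printing Implicit Defensive.
Import Order.TTheory GRing.Theory Num.Theory.
Import numFieldNormedType.Exports.
Local Open Scope classical_set_scope.
Local Open Scope ring_scope.

(* A vertex of the d-ary tree is the word of child indices read along the path
   from the root [::]; its height is its size, and its children are the words
   rcons v i. The edge from v to rcons v i is encoded as the pair (v, i). *)
Definition vertex (d : nat) : choiceType := seq 'I_d.
Definition edge (d : nat) : choiceType := (vertex d * 'I_d)%type.

Definition seq_max (R : realDomainType) (s : seq R) : R :=
  \big[Num.max/head 0 s]_(x <- s) x.
Definition seq_min (R : realDomainType) (s : seq R) : R :=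
  \big[Num.min/head 0 s]_(x <- s) x.

(* Starting the iteration at the head makes these the maximum and minimum of
   every nonempty s; the default 0 only matters for the empty sequence. *)
Lemma seq_max_mem (R : realDomainType) (s : seq R) :
  s != [::] -> seq_max s \in s.
Proof.
case: s => // a s _; rewrite /seq_max /=.
rewrite big_seq; elim/big_ind: _ => //; first exact: mem_head.
by move=> x y xs ys; rewrite /Num.max; case: ifP.
Qed.

Lemma seq_max_ge (R : realDomainType) (s : seq R) (x : R) :
  x \in s -> x <= seq_max s.
Proof. by move=> xs; rewrite /seq_max; exact: le_bigmax_seq. Qed.

Lemma seq_min_mem (R : realDomainType) (s : seq R) :
  s != [::] -> seq_min s \in s.
Proof.
case: s => // a s _; rewrite /seq_min /=.
rewrite big_seq; elim/big_ind: _ => //; first exact: mem_head.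
by move=> x y xs ys; rewrite /Num.min; case: ifP.
Qed.

Lemma seq_min_le (R : realDomainType) (s : seq R) (x : R) :
  x \in s -> seq_min s <= x.
Proof. by move=> xs; rewrite /seq_min; exact: ge_bigmin_seq. Qed.

(* Value of the position v when k moves remain; parity refers to the height
   of v. *)
Fixpoint value_rem (d : nat) (R : realDomainType) (x : edge d -> R)
    (k : nat) (v : vertex d) : R :=
  if k is k'.+1 then
    let s := [seq x (v, i) + value_rem x k' (rcons v i) | i : 'I_d] in
    if odd (size v) then seq_min s else seq_max s
  else 0.

(* Meaningful for size v <= 2n (and equal to 0 by convention beyond). *)
Definition value (d : nat) (R : realDomainType) (x : edge d -> R)
    (n : nat) (v : vertex d) : R :=
  value_rem x (n.*2 - size v) v.

Lemma value_leaf (d : nat) (R : realDomainType) (x : edge d -> R)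
    (n : nat) (v : vertex d) :
  size v = n.*2 -> value x n v = 0.
Proof. by rewrite /value => ->; rewrite subnn. Qed.

Lemma value_even (d : nat) (R : realDomainType) (x : edge d -> R)
    (n : nat) (v : vertex d) :
  (size v < n.*2)%N -> ~~ odd (size v) ->
  value x n v =
    seq_max [seq x (v, i) + value x n (rcons v i) | i : 'I_d].
Proof.
rewrite /value => vn /negPf ev; rewrite -[(n.*2 - _)%N]prednK ?subn_gt0 //=.
by rewrite ev -subnS; congr seq_max; apply: eq_map => i; rewrite size_rcons.
Qed.

Lemma value_odd (d : nat) (R : realDomainType) (x : edge d -> R)
    (n : nat) (v : vertex d) :
  (size v < n.*2)%N -> odd (size v) ->
  value x n v =
    seq_min [seq x (v, i) + value x n (rcons v i) | i : 'I_d].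
Proof.
rewrite /value => vn ov; rewrite -[(n.*2 - _)%N]prednK ?subn_gt0 //=.
by rewrite ov -subnS; congr seq_min; apply: eq_map => i; rewrite size_rcons.
Qed.

Definition game_value (d : nat) (R : realDomainType) (x : edge d -> R)
    (n : nat) : R :=
  value x n [::].

Definition mutually_independent (disp : measure_display)
    (T : measurableType disp) (R : realType) (P : probability T R)
    (I : choiceType) (X : I -> {RV P >-> R}) : Prop :=
  forall (J : seq I) (B : I -> set R),
    uniq J -> (forall i, i \in J -> measurable (B i)) ->
    P (\big[setI/setT]_(i <- J) (X i @^-1` B i)) =
    (\prod_(i <- J) P (X i @^-1` B i))%E.

Definition uniform_sign (disp : measure_display)
    (T : measurableType disp) (R : realType) (P : probability T R)
    (X : {RV P >-> R}) : Prop :=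
  P [set w | X w = 1] = (2^-1)%:E /\ P [set w | X w = -1] = (2^-1)%:E.

Definition iid_uniform_cookies (disp : measure_display)
    (T : measurableType disp) (R : realType) (P : probability T R)
    (d : nat) (X : edge d -> {RV P >-> R}) : Prop :=
  mutually_independent X /\ (forall e, uniform_sign (X e)).

(* Main.v *)
(* Let a = P(V_n > 0), b = P(V_n < 0) and let c be the probability that V_n and
   V_(n+1) differ. A first move has a positive outcome only if each reply to it
   has cookie +1 or leads to a positive position, so adding a round turns a into
   at most d ((1+a)/2)^d; a first move has a negative outcome only if its cookie
   is -1 or some reply leads to a negative position, so b becomes at most
   ((1+db)/2)^d. For d >= 15 both stay below 1/(15d), which makes the two bases
   at most q = 8/15. If V_(n+1) and V_(n+2) differ, then some grandchild of the
   root changes its value, and in addition d-1 independent events of probability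
   at most q occur, either for its siblings or for the siblings of its parent.
   Hence c shrinks at each step by the factor 4 d^2 q^(d-1) <= 1/2, and
   Borel-Cantelli shows that V_n is eventually constant. *)
Require Import Defs.
From HB Require Import structures.
From mathcomp Require Import all_boot all_order all_algebra.
From mathcomp Require Import ring lra.
From mathcomp Require Import all_classical all_reals all_analysis.
Import Order.TTheory GRing.Theory Num.Theory.
Import numFieldNormedType.Exports.
Local Open Scope classical_set_scope.
Local Open Scope ring_scope.

(** * Uniform probability on finite types, by counting *)

Section freq.
Set Implicit Arguments.
Unset Strict Implicit.
Variable R : realFieldType.
Implicit Types S : finType.

Definition freq S (A : pred S) : R := #|A|%:R / #|S|%:R.
Arguments freq : clear implicits.

Lemma freq_ge0 S (A : pred S) : 0 <= freq S A.
Proof. by rewrite divr_ge0. Qed.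

Lemma freq0 S : freq S pred0 = 0.
Proof. by rewrite /freq card0 mul0r. Qed.

Lemma freq_le1 S (A : pred S) : freq S A <= 1.
Proof.
rewrite /freq; case: (posnP #|S|) => [->|S0]; first by rewrite invr0 mulr0.
by rewrite ler_pdivrMr ?ltr0n// mul1r ler_nat max_card.
Qed.

Lemma freq_mono S (A B : pred S) :
  (forall t, A t -> B t) -> freq S A <= freq S B.
Proof.
move=> AB; rewrite ler_wpM2r ?invr_ge0// ler_nat.
by apply/subset_leq_card/fintype.subsetP => t; exact: AB.
Qed.

Lemma eq_freq S (A B : pred S) : A =1 B -> freq S A = freq S B.
Proof. by move=> AB; rewrite /freq (eq_card AB). Qed.

Lemma freqU S (A B : pred S) :
  freq S (fun t => A t || B t) <= freq S A + freq S B.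
Proof.
rewrite /freq -mulrDl ler_wpM2r ?invr_ge0// -natrD ler_nat.
by rewrite -(cardUI A B) (@eq_card _ _ [predU A & B]) ?leq_addr.
Qed.

Lemma freq_exists S (I : finType) (A : I -> pred S) :
  freq S (fun t => [exists i, A i t]) <= \sum_i freq S (A i).
Proof.
rewrite (eq_freq (B := fun t => has (A^~ t) (enum I))); last first.
  move=> t; apply/existsP/hasP => [[i Ai]|[i _ Ai]]; exists i => //.
  by rewrite mem_enum.
rewrite -[leRHS](big_enum _ _ predT)/=; elim: (enum I) => [|i s IHs].
  by rewrite big_nil freq0.
rewrite big_cons (le_trans (freqU _ _))// lerD2l; exact: IHs.
Qed.

Lemma freq_exists_le S (I : finType) (A : I -> pred S) (e : R) :
  (forall i, freq S (A i) <= e) ->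
  freq S (fun t => [exists i, A i t]) <= #|I|%:R * e.
Proof.
move=> Ae; apply: le_trans (freq_exists _) _.
by rewrite mulr_natl -sumr_const ler_sum.
Qed.

Lemma freq_forall S (I : finType) (A : I -> pred S) :
  freq {ffun I -> S} (fun t => [forall i, A i (t i)]) = \prod_i freq S (A i).
Proof.
rewrite /freq big_split/= prodr_const card_ffun natrX exprVn; congr (_ / _).
rewrite -natr_prod (_ : #|_| = #|(family A : simpl_pred {ffun I -> S})|).
  by rewrite card_family foldrE big_image.
by apply: eq_card => t; apply/forallP/familyP.
Qed.

Lemma freq_snd S (B : pred S) :
  freq (bool * S)%type (fun p => B p.2) = freq S B.
Proof.
rewrite /freq card_prod card_bool.
rewrite (@eq_card _ _ [predX predT & B])// cardX card_bool !natrM.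
by rewrite -mulf_div divff ?mul1r// pnatr_eq0.
Qed.

(** Among the pairs, [#|S|] have first component [b] and [#|B|] of the others satisfy [B]. This is
    where the bases (1 + a)/2 and (1 + d b)/2 come from. *)
Lemma freq_or S (b : bool) (B : pred S) : (0 < #|S|)%N ->
  freq (bool * S)%type (fun p => (p.1 == b) || B p.2) = (1 + freq S B) / 2.
Proof.
move=> S0; rewrite /freq card_prod card_bool.
have -> : #|[pred p : bool * S | (p.1 == b) || B p.2]| = (#|S| + #|B|)%N.
  rewrite -(cardID [pred p | p.1 == b]).
  rewrite (@eq_card _ _ [predX pred1 b & predT]); last first.
    by move=> [c s]; rewrite !inE/=; case: eqP; rewrite ?andbT ?andbF.
  rewrite cardX card1 mul1n; congr addn.
  rewrite (@eq_card _ _ [predX pred1 (~~ b) & B]) ?cardX ?card1 ?mul1n//.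
  by move=> [c s]; rewrite !inE/=; case: c; case: b.
by rewrite natrD natrM; field; rewrite pnatr_eq0 -lt0n S0.
Qed.

End freq.
Arguments freq {R S}.
Arguments freq_ge0 {R S}.

(** * Independence of coordinates in a finite power *)

Section product_space.
Set Implicit Arguments.
Unset Strict Implicit.
Variable R : realFieldType.

(** The product formula with [D] at coordinate [i] and [E] elsewhere. It will give the factor
    [q ^+ d.-1]: a change at one child, a constraint on each sibling. *)
Lemma freq_isolate (S I : finType) (D E : pred S) (i : I) :
  freq (S := {ffun I -> S})
    (fun t => D (t i) && [forall i', (i' == i) || E (t i')]) =
  freq D * freq E ^+ #|I|.-1 :> R.
Proof.
rewrite (eq_freq _ (B := fun t : {ffun I -> S} =>
  [forall i', (if i' == i then D else E) (t i')])); last first.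
  move=> t; apply/andP/forallP => [[Di /forallP Ei] i'|DE].
    by have := Ei i'; case: eqP => [->|].
  split; first by have := DE i; rewrite eqxx.
  by apply/forallP => i'; have := DE i'; case: eqP.
rewrite (freq_forall _ (fun i' => if i' == i then D else E)) (bigD1 i)//= eqxx; congr (_ * _).
rewrite (eq_bigr (fun=> freq E)); last by move=> i' /negPf ->.
rewrite prodr_const; congr (_ ^+ _).
by rewrite (cardD1 i predT)/=; apply: eq_card => x; rewrite !inE andbT.
Qed.

Lemma freq_coord (S I : finType) (D : pred S) (i : I) :
  freq (S := {ffun I -> S}) (fun t => D (t i)) <= freq D :> R.
Proof.
apply: le_trans (_ : freq (S := {ffun I -> S})
    (fun t => D (t i) && [forall i', (i' == i) || predT (t i')]) <= _).
  by apply: freq_mono => t ->; apply/forallP => i'; rewrite orbT.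
by rewrite freq_isolate ler_piMr ?freq_ge0// exprn_ile1 ?freq_ge0 ?freq_le1.
Qed.

End product_space.

(** * Two levels of play on top of given values *)

Section round.
Set Implicit Arguments.
Unset Strict Implicit.
Variables (R : realFieldType) (d : nat).
Hypothesis d_gt0 : (0 < d)%N.

Definition cookie (b : bool) : R := if b then 1 else -1.

Lemma image_ord_neq0 (F : 'I_d -> R) : [seq F i | i : 'I_d] != [::].
Proof. by rewrite -size_eq0 size_image card_ord -lt0n. Qed.

Lemma seq_min_attained (F : 'I_d -> R) :
  exists i, seq_min [seq F i | i : 'I_d] = F i.
Proof. by have /mapP[i _ ->] := seq_min_mem (image_ord_neq0 F); exists i. Qed.

Lemma seq_max_attained (F : 'I_d -> R) :
  exists i, seq_max [seq F i | i : 'I_d] = F i.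
Proof. by have /mapP[i _ ->] := seq_max_mem (image_ord_neq0 F); exists i. Qed.

Variable S : finType.
Implicit Types f g : S -> R.

(** A point of [G] records the cookies of the two top levels and an element of [S] at each
    grandchild of the root; [f] and [g] turn that element into a value. *)
Let Q := {ffun 'I_d -> (bool * S)%type}.
Let G := {ffun 'I_d -> (bool * Q)%type}.
Implicit Types t : G.

Definition reply f (p : bool * Q) : R :=
  cookie p.1 + seq_min [seq cookie (p.2 j).1 + f (p.2 j).2 | j : 'I_d].

Definition round f t : R :=
  seq_max [seq reply f (t i) | i : 'I_d].

Lemma reply_le f p j : reply f p <= cookie p.1 + (cookie (p.2 j).1 + f (p.2 j).2).
Proof. by rewrite lerD2l; apply/seq_min_le/mapP; exists j; rewrite ?mem_enum. Qed.

Lemma le_round f t i : reply f (t i) <= round f t.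
Proof. by apply/seq_max_ge/mapP; exists i; rewrite ?mem_enum. Qed.

(** An answer with cookie -1 to a position with [f <= 0] caps the total at 1 - 1 = 0. *)
Lemma reply_gt0 f p : 0 < reply f p ->
  [forall j, ((p.2 j).1 == true) || (0 < f (p.2 j).2)].
Proof.
move=> p0; apply/forallP => j; have := lt_le_trans p0 (reply_le f p j).
by rewrite /cookie; case: (p.2 j).1 => //=; case: p.1 => ?; lra.
Qed.

(** After a first cookie +1 the best answer must total less than -1, and its own cookie accounts for
    at most -1 of that. *)
Lemma reply_lt0 f p : reply f p < 0 ->
  (p.1 == false) || [exists j, f (p.2 j).2 < 0].
Proof.
rewrite /reply; have [j ->] :=
  seq_min_attained (fun j => cookie (p.2 j).1 + f (p.2 j).2).
case: p.1 => //= p0; apply/existsP; exists j; move: p0.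
by rewrite /cookie; case: (p.2 j).1 => ?; lra.
Qed.

Lemma reply_neq f g p : reply f p != reply g p ->
  [exists j, f (p.2 j).2 != g (p.2 j).2].
Proof.
apply: contraNT => /existsPn fg; rewrite /reply; apply/eqP; congr (_ + seq_min _).
by apply: eq_map => j; have := fg j; rewrite negbK => /eqP ->.
Qed.

(* The best first move for g has either a positive outcome, which constrains all
   replies to it, or a nonpositive one, and then all first moves for f have a
   negative outcome. *)
Lemma round_lt f g t : round f t < round g t ->
  [exists i, [exists j, (f ((t i).2 j).2 != g ((t i).2 j).2) &&
     [forall j', (j' == j) ||
        ((((t i).2 j').1 == true) || (0 < g ((t i).2 j').2))]]] ||
  [exists i, [exists j, f ((t i).2 j).2 != g ((t i).2 j).2] &&
     [forall i', (i' == i) ||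
        (((t i').1 == false) || [exists j, f ((t i').2 j).2 < 0])]].
Proof.
have [i gi] := seq_max_attained (fun i => reply g (t i)).
rewrite [X in _ < X]/round gi => fg.
have fi k : reply f (t k) < reply g (t i) := le_lt_trans (le_round f t k) fg.
have /existsP[j fgj] : [exists j, f ((t i).2 j).2 != g ((t i).2 j).2].
  by apply: reply_neq; rewrite lt_eqF.
case: (ltP 0 (reply g (t i))) => [g0|g0]; apply/orP; [left|right].
  apply/existsP; exists i; apply/existsP; exists j; rewrite fgj/=.
  apply/forallP => j'; apply/orP; right; exact: (forallP (reply_gt0 g0) j').
apply/existsP; exists i; apply/andP; split; first by apply/existsP; exists j.
apply/forallP => i'; apply/orP; right; apply: reply_lt0.
exact: lt_le_trans (fi i') g0.
Qed.

Hypothesis S_gt0 : (0 < #|S|)%N.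
Variable q : R.

Let Q_gt0 : (0 < #|Q|)%N.
Proof. by rewrite card_ffun expn_gt0 card_prod card_bool muln_gt0 S_gt0. Qed.

Lemma freq_reply_gt0 f : 1 + freq (R := R) (fun s => 0 < f s) <= 2 * q ->
  freq (fun p : (bool * S)%type => (p.1 == true) || (0 < f p.2)) <= q.
Proof. by move=> fq; rewrite (freq_or _ _ (fun s => 0 < f s))//; lra. Qed.

Lemma freq_reply_lt0 f : 1 + d%:R * freq (R := R) (fun s => f s < 0) <= 2 * q ->
  freq (fun p : (bool * Q)%type =>
    (p.1 == false) || [exists j, f (p.2 j).2 < 0]) <= q.
Proof.
move=> fq; rewrite (freq_or _ _ (fun s : Q => [exists j, f (s j).2 < 0]))//.
suff : freq (R := R) (fun s : Q => [exists j, f (s j).2 < 0]) <=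
       d%:R * freq (R := R) (fun s => f s < 0).
  by move=> h; rewrite ler_pdivrMr// mulrC (le_trans _ fq)// lerD2l.
rewrite -[in leRHS](card_ord d).
apply: (freq_exists_le (A := fun j (s : Q) => f (s j).2 < 0)) => j.
apply: le_trans (freq_coord _ (fun p => f p.2 < 0) j) _.
by rewrite (freq_snd _ (fun s => f s < 0)).
Qed.

(** Union bound over the first moves; for a fixed move, the conditions on its [d] answers are
    independent. *)
Lemma freq_round_gt0 f : 1 + freq (R := R) (fun s => 0 < f s) <= 2 * q ->
  freq (fun t => 0 < round f t) <= d%:R * q ^+ d.
Proof.
move=> fq; rewrite -[in leRHS](card_ord d).
apply: (le_trans (y := freq (R := R) (fun t =>
  [exists i, [forall j, (((t i).2 j).1 == true) || (0 < f ((t i).2 j).2)]]))).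
  apply: freq_mono => t; have [i ti] := seq_max_attained (fun i => reply f (t i)).
  by rewrite /round ti => /reply_gt0 ?; apply/existsP; exists i.
apply: (freq_exists_le (A := fun i t =>
  [forall j, (((t i).2 j).1 == true) || (0 < f ((t i).2 j).2)])) => i.
apply: le_trans (freq_coord _ (fun p : (bool * Q)%type =>
  [forall j, ((p.2 j).1 == true) || (0 < f (p.2 j).2)]) i) _.
rewrite (freq_snd _ (fun s : Q =>
  [forall j, ((s j).1 == true) || (0 < f (s j).2)])).
rewrite (freq_forall _ (fun _ p => (p.1 == true) || (0 < f p.2))).
by rewrite prodr_const lerXn2r ?nnegrE ?freq_ge0 ?freq_reply_gt0//
  (le_trans (freq_ge0 _) (freq_reply_gt0 fq)).
Qed.

(** All [d] first moves must lose, and these are independent events; the union bound over answers is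
    already inside [q]. *)
Lemma freq_round_lt0 f : 1 + d%:R * freq (R := R) (fun s => f s < 0) <= 2 * q ->
  freq (fun t => round f t < 0) <= q ^+ d.
Proof.
move=> fq.
apply: (le_trans (y := freq (R := R) (fun t =>
  [forall i, ((t i).1 == false) || [exists j, f ((t i).2 j).2 < 0]]))).
  apply: freq_mono => t t0; apply/forallP => i; apply: reply_lt0.
  exact: le_lt_trans (le_round f t i) t0.
rewrite (freq_forall _ (fun _ (p : (bool * Q)%type) =>
  (p.1 == false) || [exists j, f (p.2 j).2 < 0])).
by rewrite prodr_const card_ord lerXn2r ?nnegrE ?freq_ge0 ?freq_reply_lt0//
  (le_trans (freq_ge0 _) (freq_reply_lt0 fq)).
Qed.

(** Each event of [round_lt] leaves [d ^ 2] choices for the changed grandchild, at a cost of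
    [e * q ^+ d.-1] each. *)
Lemma freq_round_lt f g :
  1 + freq (R := R) (fun s => 0 < g s) <= 2 * q ->
  1 + d%:R * freq (R := R) (fun s => f s < 0) <= 2 * q ->
  freq (fun t => round f t < round g t) <=
    2 * d%:R ^+ 2 * q ^+ d.-1 * freq (fun s => f s != g s).
Proof.
move=> gq fq; set e := freq (R := R) (fun s => f s != g s).
have q0 : 0 <= q := le_trans (freq_ge0 _) (freq_reply_gt0 gq).
have e0 : 0 <= e by exact: freq_ge0.
apply: le_trans (freq_mono _ (@round_lt f g)) _.
apply: le_trans (freqU _ _ _) _.
suff [h1 h2] :
  freq (R := R) (fun t =>
    [exists i, [exists j, (f ((t i).2 j).2 != g ((t i).2 j).2) &&
     [forall j', (j' == j) ||
        ((((t i).2 j').1 == true) || (0 < g ((t i).2 j').2))]]])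
    <= d%:R * (d%:R * (e * q ^+ d.-1)) /\
  freq (R := R) (fun t =>
    [exists i, [exists j, f ((t i).2 j).2 != g ((t i).2 j).2] &&
     [forall i', (i' == i) ||
        (((t i').1 == false) || [exists j, f ((t i').2 j).2 < 0])]])
    <= d%:R * (d%:R * e * q ^+ d.-1).
  by apply: le_trans (lerD h1 h2) _; rewrite le_eqVlt; apply/orP; left; apply/eqP; ring.
split; rewrite -[in leRHS](card_ord d).
  (* The change and the constrained siblings lie below the same first move, so the coordinates
     separated are those of [Q]. *)
  apply: (freq_exists_le (A := fun i t =>
    [exists j, (f ((t i).2 j).2 != g ((t i).2 j).2) &&
     [forall j', (j' == j) ||
        ((((t i).2 j').1 == true) || (0 < g ((t i).2 j').2))]])) => i.
  pose A j (s : Q) := (f (s j).2 != g (s j).2) &&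
     [forall j', (j' == j) || (((s j').1 == true) || (0 < g (s j').2))].
  apply: le_trans (freq_coord _ (fun p : (bool * Q)%type =>
    [exists j, A j p.2]) i) _.
  rewrite (freq_snd _ (fun s : Q => [exists j, A j s])).
  apply: freq_exists_le => j; rewrite /A.
  rewrite (freq_isolate _ (fun p => f p.2 != g p.2)
    (fun p => (p.1 == true) || (0 < g p.2))).
  rewrite (freq_snd _ (fun s => f s != g s)) ler_wpM2l//.
  by rewrite lerXn2r ?nnegrE ?freq_ge0 ?freq_reply_gt0.
(* Now the constraints sit at the other first moves, so the coordinates separated are those of
   [G]. *)
apply: (freq_exists_le (A := fun i t =>
  [exists j, f ((t i).2 j).2 != g ((t i).2 j).2] &&
   [forall i', (i' == i) ||
      (((t i').1 == false) || [exists j, f ((t i').2 j).2 < 0])])) => i.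
rewrite (freq_isolate _ (fun p : (bool * Q)%type =>
    [exists j, f (p.2 j).2 != g (p.2 j).2])
  (fun p => (p.1 == false) || [exists j, f (p.2 j).2 < 0])).
rewrite ler_pM ?exprn_ge0 ?freq_ge0//; last first.
  by rewrite card_ord lerXn2r ?nnegrE ?freq_ge0 ?freq_reply_lt0.
rewrite (freq_snd _ (fun s : Q => [exists j, f (s j).2 != g (s j).2])).
apply: (freq_exists_le (A := fun j (s : Q) => f (s j).2 != g (s j).2)) => j.
apply: le_trans (freq_coord _ (fun p => f p.2 != g p.2) j) _.
by rewrite (freq_snd _ (fun s => f s != g s)).
Qed.

Lemma freq_round_neq f g :
  1 + freq (R := R) (fun s => 0 < f s) <= 2 * q ->
  1 + freq (R := R) (fun s => 0 < g s) <= 2 * q ->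
  1 + d%:R * freq (R := R) (fun s => f s < 0) <= 2 * q ->
  1 + d%:R * freq (R := R) (fun s => g s < 0) <= 2 * q ->
  freq (fun t => round f t != round g t) <=
    4 * d%:R ^+ 2 * q ^+ d.-1 * freq (fun s => f s != g s).
Proof.
move=> f0 g0 f1 g1; under eq_freq do rewrite neq_lt.
have h1 := freq_round_lt g0 f1; have h2 := freq_round_lt f0 g1.
have e : freq (fun s => g s != f s) = freq (fun s => f s != g s) :> R.
  by apply: eq_freq => s; rewrite eq_sym.
rewrite e in h2.
by apply: le_trans (freqU _ _ _) _; lra.
Qed.

End round.

(** * Finite trees of cookies and the numerical bounds for d >= 15 *)

Section tree.
Set Implicit Arguments.
Unset Strict Implicit.
Variables (R : realFieldType) (d : nat).

(** Cookies of the top [k] levels, as bits. [tree k.+2] unfolds to [G] over [tree k], and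
    [tree_value j.+2 false] to [round (tree_value j false)], so the bounds on rounds apply by
    conversion. *)
Fixpoint tree k : finType :=
  if k is k'.+1 then {ffun 'I_d -> (bool * tree k')%type} else unit.

(* Only meaningful when j <= k: on shallower trees the play is cut short. *)
Fixpoint tree_value j k (b : bool) : tree k -> R :=
  if k is k'.+1 then fun t : {ffun 'I_d -> (bool * tree k')%type} =>
    if j is j'.+1 then
      let s := [seq cookie R (t i).1 + tree_value j' (~~ b) (t i).2 | i : 'I_d] in
      if b then seq_min s else seq_max s
    else 0
  else fun=> 0.

Fixpoint label k : tree k -> vertex d -> 'I_d -> bool :=
  if k is k'.+1 then fun (t : {ffun 'I_d -> (bool * tree k')%type}) v i =>
    if v is i0 :: v' then label (t i0).2 v' i else (t i).1
  else fun _ _ _ => true.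

Fixpoint tree_edges k : seq (edge d) :=
  if k is k'.+1 then
    [seq ([::], i) | i <- enum 'I_d] ++
    [seq (i :: e.1, e.2) | i <- enum 'I_d, e <- tree_edges k']
  else [::].

(** The test [== 1] loses nothing as long as [x] only takes the values 1 and -1. *)
Fixpoint restriction (x : edge d -> R) k (v : vertex d) : tree k :=
  if k is k'.+1 then
    [ffun i => (x (v, i) == 1, restriction x k' (rcons v i))]
  else tt.

(** Mutual independence is stated for duplicate-free lists of edges. *)
Lemma tree_edges_uniq k : uniq (tree_edges k).
Proof.
elim: k => //= k IHk; rewrite cat_uniq map_inj_uniq ?enum_uniq//=; last first.
  by move=> i j [].
apply/andP; split; last first.
  apply: allpairs_uniq; rewrite ?enum_uniq//.
  by move=> [i [v j]] [i' [v' j']] _ _ /= [-> -> ->].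
apply/hasPn => -[v j] /allpairsP[[i e] [_ _ [-> _]]].
by apply/negP => /mapP[].
Qed.

Lemma card_tree k : #|tree k| = (2 ^ size (tree_edges k))%N.
Proof.
elim: k => [|k IHk] /=; first by rewrite card_unit.
rewrite size_cat size_map size_allpairs size_enum_ord.
by rewrite card_ffun card_prod card_bool card_ord IHk -expnS -expnM mulnC mulnS.
Qed.

Lemma tree_edges_size k e : e \in tree_edges k -> (size e.1 < k)%N.
Proof.
elim: k e => //= k IHk e; rewrite mem_cat => /orP[/mapP[i _ ->]//|].
by case/allpairsP => -[i e'] [_ /IHk ? ->].
Qed.

Lemma label_restriction x k v u i : (size u < k)%N ->
  label (restriction x k v) u i = (x (v ++ u, i) == 1).
Proof.
elim: k v u => //= k IHk v [|j u] uk; rewrite ffunE/= ?cats0//.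
by rewrite IHk// cat_rcons.
Qed.

(** Allowing [j < k] lets games of different lengths be read on one tree. *)
Lemma value_restriction x j k v : (forall e, x e = 1 \/ x e = -1) ->
  (j <= k)%N ->
  value_rem x j v = tree_value j (odd (size v)) (restriction x k v).
Proof.
move=> x1; elim: j k v => [|j IHj] [|k] v jk //=.
have e i : x (v, i) + value_rem x j (rcons v i) =
    cookie R ([ffun i => (x (v, i) == 1, restriction x k (rcons v i))] i).1 +
    tree_value j (~~ odd (size v))
     ([ffun i => (x (v, i) == 1, restriction x k (rcons v i))] i).2.
  rewrite ffunE/= (IHj k)// size_rcons; congr (_ + _).
  rewrite /cookie; have [->|->] := x1 (v, i); rewrite ?eqxx//.
  by case: eqP => //; lra.
by case: ifP => od; [congr seq_min|congr seq_max]; apply: eq_map => i; rewrite e od.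
Qed.

Lemma tree_value0 k b (t : tree k) : tree_value 0 b t = 0.
Proof. by case: k t. Qed.

Hypothesis d15 : (15 <= d)%N.
Let q : R := 8 / 15.
Let d0 : (0 < d)%N. Proof. exact: leq_trans d15. Qed.
Let d15r : (15 : R) <= d%:R. Proof. by rewrite (ler_nat _ 15). Qed.

(** One inequality serves twice: it yields d q^d <= 1/(15 d) and 4 d^2 q^(d-1) <= 1/2. *)
Lemma exponential_gain : 15 * d%:R ^+ 2 * q ^+ d <= 1 :> R.
Proof.
rewrite -(subnKC d15); elim: (d - 15)%N => [|m IHm].
  (* For d = 15 the claim is q^15 <= 15^-3, the cube of this bound. *)
  have h : q ^+ 5 <= 15^-1 by rewrite /q; lra.
  have q0 : 0 <= q by rewrite /q; lra.
  rewrite addn0 -[15%N]/(5 * 3)%N exprM.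
  have : (q ^+ 5) ^+ 3 <= 15^-1 ^+ 3 by rewrite lerXn2r ?nnegrE ?exprn_ge0 ?invr_ge0.
  lra.
apply: le_trans IHm; rewrite addnS (exprS q).
have : (15 : R) <= (15 + m)%:R by rewrite (ler_nat _ 15) leq_addr.
rewrite -[(15 + m).+1]addn1 (natrD _ (15 + m) 1); set y := (15 + m)%:R => y15.
have : 0 <= q ^+ (15 + m) by rewrite exprn_ge0// /q; lra.
(* Passing from y to y + 1 multiplies by q (1 + 1/y)^2, which is below 1 for y >= 15. *)
set z := q ^+ _ => z0; rewrite [leLHS]mulrA ler_wpM2r// /q; nra.
Qed.

Lemma tree_card_gt0 k : (0 < #|tree k|)%N.
Proof. by rewrite card_tree expn_gt0. Qed.

Let D0 : 0 < 15 * d%:R :> R.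
Proof. by have := d15r; lra. Qed.

Let q_gt0 (a : R) : a <= (15 * d%:R)^-1 -> 1 + a <= 2 * q.
Proof.
have : (15 * d%:R)^-1 <= 15^-1 :> R by rewrite lef_pV2 ?posrE//; have := d15r; lra.
by rewrite /q; lra.
Qed.

(** The factor d of the union bound cancels the one in 1/(15 d), leaving (1 + 1/15)/2 = 8/15, the
    value of [q]. *)
Let q_lt0 (b : R) : b <= (15 * d%:R)^-1 -> 1 + d%:R * b <= 2 * q.
Proof.
move=> /(ler_wpM2l (ler0n R d)).
have -> : d%:R * (15 * d%:R)^-1 = 15^-1 :> R by field; rewrite pnatr_eq0 -lt0n.
by rewrite /q; lra.
Qed.

(** [j] and [k] are decoupled so that two game lengths can be bounded on the same tree; if either is
    0, the value is constantly 0. *)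
Lemma freq_tree_value k j :
  freq (fun t : tree k.*2 => 0 < tree_value j.*2 false t) <= (15 * d%:R)^-1 :> R /\
  freq (fun t : tree k.*2 => tree_value j.*2 false t < 0) <= (15 * d%:R)^-1 :> R.
Proof.
elim: k j => [|k IHk] [|j]; rewrite ?doubleS;
  try by split; rewrite (eq_freq _ (B := pred0)) ?freq0 ?invr_ge0 ?(ltW D0)// => t;
    rewrite /= ?tree_value0 ltxx.
have [h1 h2] := IHk j; have g := exponential_gain.
have dq : d%:R * q ^+ d <= (15 * d%:R)^-1.
  by rewrite -div1r ler_pdivlMr//; lra.
split.
  exact: le_trans (freq_round_gt0 d0 (tree_card_gt0 _) (q_gt0 h1)) dq.
apply: le_trans (freq_round_lt0 d0 (tree_card_gt0 _) (q_lt0 h2)) _.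
apply: le_trans dq; rewrite ler_peMl ?exprn_ge0 ?ler1n//.
by rewrite /q; lra.
Qed.

Lemma freq_value_change n :
  freq (fun t : tree n.+1.*2 =>
    tree_value n.*2 false t != tree_value n.+1.*2 false t) <= 2^-1 ^+ n :> R.
Proof.
elim: n => [|n IHn]; first exact: freq_le1.
(* Both lengths are taken on the tree of depth [n.+1.*2]; two more levels on top give the tree of
   the next step. *)
have [a1 a2] := freq_tree_value n.+1 n.
have [b1 b2] := freq_tree_value n.+1 n.+1.
apply: le_trans (freq_round_neq d0 (tree_card_gt0 _)
  (q_gt0 a1) (q_gt0 b1) (q_lt0 a2) (q_lt0 b2)) _.
rewrite (exprS 2^-1) ler_pM ?freq_ge0//.
  by rewrite mulr_ge0 ?exprn_ge0 ?mulr_ge0// /q; lra.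
(* Since 15 * 8/15 = 2 * 4, the gain says that twice the contraction factor is at most 1. *)
have := exponential_gain; rewrite -[in _ ^+ d](prednK d0) (exprS q) mulrA.
rewrite (_ : _ * q = 2 * (4 * d%:R ^+ 2)); last by rewrite /q; field.
lra.
Qed.

End tree.

(** * Transfer from counting to the probability [P] *)

Section cylinder.
Set Implicit Arguments.
Unset Strict Implicit.
Variables (disp : measure_display) (T : measurableType disp) (R : realType).
Variables (P : probability T R) (d : nat) (X : edge d -> {RV P >-> R}).
Hypothesis iidX : iid_uniform_cookies X.

Definition cylinder k (t : tree d k) : set T :=
  \big[setI/setT]_(e <- tree_edges d k)
    (X e @^-1` [set cookie R (label t e.1 e.2)]).

Lemma measurable_cylinder k (t : tree d k) : measurable (cylinder t).
Proof.
rewrite /cylinder; apply: bigsetI_measurable => e _.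
exact: measurable_funPTI.
Qed.

Lemma prob_cookie e b : P (X e @^-1` [set cookie R b]) = (2^-1)%:E.
Proof. by case: iidX => _ /(_ e)[X1 X2]; rewrite /cookie; case: b. Qed.

(** Independence gives one factor 1/2 per edge, and [tree d k] has one bit per edge: its uniform
    count is the law of the top cookies. *)
Lemma prob_cylinder k (t : tree d k) : P (cylinder t) = (#|tree d k|%:R^-1)%:E.
Proof.
case: iidX => indX _; rewrite /cylinder.
rewrite (indX _ (fun e => [set cookie R (label t e.1 e.2)])) ?tree_edges_uniq//.
under eq_bigr do rewrite prob_cookie.
rewrite card_tree natrX -exprVn; elim: (tree_edges d k) => [|e s IHs].
  by rewrite big_nil.
by rewrite big_cons IHs -EFinM -exprS.
Qed.

Definition tree_event k (A : pred (tree d k)) : set T :=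
  \big[setU/set0]_(t | A t) cylinder t.

Lemma measurable_tree_event k (A : pred (tree d k)) : measurable (tree_event A).
Proof.
apply: bigsetU_measurable => t _; exact: measurable_cylinder.
Qed.

Lemma prob_tree_event k (A : pred (tree d k)) :
  (P (tree_event A) <= (freq A : R)%:E)%E.
Proof.
have -> : (freq A : R)%:E = (\sum_(t | A t) P (cylinder t))%E.
  under eq_bigr do rewrite prob_cylinder.
  by rewrite sumEFin sumr_const /freq mulr_natl.
(* Measurability is carried along because subadditivity asks for it at each union. *)
suff [] : measurable (tree_event A) /\
    (P (tree_event A) <= \sum_(t | A t) P (cylinder t))%E by [].
rewrite /tree_event; elim/big_ind2: _ => [|b B c C [mB Bb] [mC Cc]|t _].
- by split; rewrite ?measure0.
- split; first exact: measurableU.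
  by apply: (@le_trans _ _ (P B + P C)%E); [exact: measureU2|exact: leeD].
- by split => //; exact: measurable_cylinder.
Qed.

(** [uniform_sign] leaves room for other values on a null set; as there are countably many edges,
    one null set covers them all. *)
Lemma ae_sign : {ae P, forall w, forall e, X e w = 1 \/ X e w = -1}.
Proof.
have ae1 e : {ae P, forall w, X e w = 1 \/ X e w = -1}.
  have mX c : measurable (X e @^-1` [set c]) by exact: measurable_funPTI.
  exists (~` (X e @^-1` [set 1] `|` X e @^-1` [set -1])); split.
  - by apply: measurableC; exact: measurableU.
  - rewrite probability_setC; last exact: measurableU.
    rewrite measureU//; last first.
      by rewrite -subset0 => w [/= -> h]; exfalso; lra.
    rewrite [X in (1 - X)%E](_ : _ = (2^-1 + 2^-1)%:E); last first.
      rewrite EFinD; congr (_ + _)%E; first exact: (prob_cookie e true).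
      exact: (prob_cookie e false).
    by rewrite (_ : 2^-1 + 2^-1 = 1 :> R) ?subee//; lra.
  - exact: subset_refl.
have aen n : {ae P, forall w, forall e, unpickle n = Some e ->
    X e w = 1 \/ X e w = -1}.
  case: (unpickle n) => [e|]; last exact: aeW.
  by apply: filterS (ae1 e) => w Xe _ [<-].
apply: filterS (ae_foralln aen) => w Xw e.
exact: Xw (pickle e) e (pickleK e).
Qed.

Lemma cylinder_restriction k w : (forall e, X e w = 1 \/ X e w = -1) ->
  cylinder (restriction (fun e => X e w) k [::]) w.
Proof.
move=> X1; rewrite /cylinder big_seq; elim/big_ind: _ => //.
move=> [u i] /tree_edges_size/= uk /=; rewrite label_restriction//= /cookie.
by have [->|->] := X1 (u, i); case: eqP => //; lra.
Qed.

Lemma tree_eventP k (A : pred (tree d k)) w :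
  (forall e, X e w = 1 \/ X e w = -1) ->
  A (restriction (fun e => X e w) k [::]) -> tree_event A w.
Proof.
move=> X1 At; rewrite /tree_event (bigD1 _ At)/=; left.
exact: cylinder_restriction.
Qed.

End cylinder.

(** * Borel-Cantelli and almost sure convergence *)

Theorem theorem1p3 (disp : measure_display) (T : measurableType disp)
    (R : realType) (P : probability T R) (d : nat)
    (X : edge d -> {RV P >-> R}) :
  (15 <= d)%N ->
  iid_uniform_cookies X ->
  {ae P, forall w, cvgn (fun n : nat => game_value (fun e => X e w) n)}.
Proof.
move=> d15 iidX.
pose changes n : pred (tree d n.+1.*2) := fun t =>
  tree_value R n.*2 false t != tree_value R n.+1.*2 false t.
(* Up to the null set of [ae_sign], [E n] contains the event that V_n and V_(n+1) differ. *)
pose E n := tree_event X (changes n).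
have E0 : P (lim_sup_set E) = 0%E.
  apply: lim_sup_set_cvg0 => [n|]; first exact: measurable_tree_event.
  (* With numerator 2 the terms are 2/2^(n+1) = 2^-n, matching [freq_value_change]; their sum is
     2. *)
  have cg := @cvg_geometric_eseries_half R 2 0.
  apply: (@le_lt_trans _ _ (2 / 2 ^+ 0)%:E); last exact: ltry.
  rewrite -(cvg_lim _ cg)//; apply: lee_nneseries => // n _.
  apply: le_trans (prob_tree_event iidX _) _; rewrite lee_fin.
  apply: le_trans (freq_value_change R d15 n) _.
  by rewrite addn1 expnS natrM natrX invfM mulrA divff// mul1r exprVn.
have nE : {ae P, forall w, ~ lim_sup_set E w}.
  exists (lim_sup_set E); split => //; last by move=> w /= /contrapT.
  apply: bigcap_measurable => // n _; apply: bigcup_measurable => k _.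
  exact: measurable_tree_event.
apply: filterS2 nE (ae_sign iidX) => w nEw X1.
have stable n : ~ E n w ->
    game_value (fun e => X e w) n.+1 = game_value (fun e => X e w) n.
  apply: contra_notP => /eqP V; apply: tree_eventP => //.
  rewrite /changes eq_sym; move: V; rewrite /game_value /value !subn0.
  by rewrite !(value_restriction (k := n.+1.*2))// leq_double.
(* Outside the limsup only finitely many [E n] occur, so the values are constant from [N] on. *)
have [N NE] : exists N, forall n, (N <= n)%N -> ~ E n w.
  apply: contra_notP nEw => /forallNP H N _; apply: contrapT => nH.
  by apply: (H N) => n Nn En; apply: nH; exists n.
apply/cvg_ex; exists (game_value (fun e => X e w) N).
apply: cvg_near_cst; exists N => // n /= /subnKC <-.
by elim: (n - N)%N => [|m IHm]; rewrite ?addn0// addnS stable//; apply: NE; rewrite leq_addr.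
Qed.
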